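(* For integers $m\ge 0$ and $i$, let \[ d_i(m)=2^{-2m}\sum_{k=i}^{m}2^k\binom{2m-2k}{m-k}\binom{m+k}{k}\binom{k}{i}, \] with the convention that $d_i(m)=0$ when $i<0$ or $i>m$. Then for every integer $m\ge 2$ and every $i$ with $0\le i\le m$, \[ d_i(m)\,d_{i+1}(m+1)>d_{i+1}(m)\,d_i(m+1) \] and \[ d_i(m)\,d_i(m+1)>d_{i-1}(m)\,d_{i+1}(m+1). \]
   Context: For $0\le i\le m$, $d_i(m)$ is the coefficient of $x^i$ in the Boros–Moll polynomial $P_m(x)=\sum_{j,k}\binom{2m+1}{2j}\binom{m-j}{k}\binom{2k+2j}{k+j}\frac{(x+1)^j(x-1)^k}{2^{3(k+j)}}$; these coefficients are positive. Together the two inequalities say that the ratios $r_i(m)=d_i(m)/d_{i+1}(m)$ interlace the ratios $r_i(m+1)$, i.e. $r_0(m+1)\le r_0(m)\le r_1(m+1)\le r_1(m)\le\cdots\le r_{m-1}(m+1)\le r_{m-1}(m)\le r_m(m+1)$ (the Boros–Moll polynomials are ''interlacing log-concave''). *)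

(* Defs.v *)
From mathcomp Require Import all_boot all_order all_algebra.

Set Implicit Arguments.
Unset Strict Implicit.
Unset Printing Implicit Defensive.

Import Order.TTheory GRing.Theory Num.Theory.
Local Open Scope ring_scope.

(* [boros_moll_coef m i] is d_i(m).  The index is an integer so that d_{i-1}(m)
   at i = 0 is the zero given by the convention, free of truncated subtraction;
   in the first branch [`|i|%N] is just i seen as a natural number. *)
Definition boros_moll_coef (m : nat) (i : int) : rat :=
  if 0 <= i <= m%:Z then
    2%:R ^- (2 * m) *
    \sum_(`|i|%N <= k < m.+1)
       (2 ^ k * 'C(2 * m - 2 * k, m - k) * 'C(m + k, k) * 'C(k, `|i|))%:R
  else 0.

(* Main.v *)
(* Write a_j = d_j(m).  The weights of the binomials C(k, j) in a_j are
   hypergeometric in k and in m, which yields the two recurrences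
     2 (m+1) d_{j+1}(m+1) = 2 (m+j+1) a_j + (4m+2j+5) a_{j+1},
     (m-j)(m+j+1) a_j + (j+1)(j+2) a_{j+2} = (j+1)(2m+1) a_{j+1}.
   Downward induction on j in the second one gives (j+1) a_{j+1} <= (m-j) a_j,
   and then the sharper (j+1)(m+j+2) a_{j+1} <= (m-j)(m+j+1) a_j.  By the first
   recurrence, the second inequality of the theorem is the positivity of a
   quadratic form in a_j, a_{j+1}, a_{j+2}; eliminating a_{j+2} and the excess in
   the sharper bound leaves only positive coefficients.  The same positivity
   contains log-concavity of (a_j), which is what the first inequality needs. *)
Require Import Defs.
From mathcomp Require Import all_boot all_order all_algebra.
From mathcomp Require Import zify ring lra.

Import Order.TTheory GRing.Theory Num.Theory.
Local Open Scope ring_scope.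

(* Meaningful only for [k <= m]: beyond that, truncated subtraction makes the
   central binomial coefficient 1 instead of 0. *)
Definition bm_weight (m k : nat) : rat :=
  2%:R ^- (2 * m) *
  (2 ^ k * 'C(2 * m - 2 * k, m - k) * 'C(m + k, k))%:R.

(** The range of [k] does not depend on [j]: the terms with [k < j] vanish with the binomial, so
    recurrences in [j] can be checked under one fixed sum. *)
Definition bm_nat (m j : nat) : rat :=
  \sum_(k < m.+1) bm_weight m k * 'C(k, j)%:R.

Lemma boros_moll_coef_nat (m j : nat) : boros_moll_coef m j%:Z = bm_nat m j.
Proof.
rewrite /boros_moll_coef /bm_nat lez_nat /=.
case: leqP => [le_jm|lt_mj]; last first.
  rewrite big1 // => k _; rewrite bin_small ?mulr0 //.
  exact: leq_trans (ltn_ord k) lt_mj.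
rewrite -(big_mkord xpredT (fun k => bm_weight m k * 'C(k, j)%:R)).
rewrite [RHS](big_cat_nat (n := j)) //=; last by rewrite ltnW.
rewrite [X in X + _]big1_seq; last first.
  move=> k /andP[_]; rewrite mem_index_iota => /andP[_ lt_kj].
  by rewrite bin_small ?mulr0.
rewrite add0r mulr_sumr; apply: eq_bigr => k _.
by rewrite natrM mulrA.
Qed.

(** * Hypergeometric relations between the weights *)

Lemma central_binS (p : nat) :
  (p%:R + 1) * ('C(2 * p.+1, p.+1))%:R =
  2 * (2 * p%:R + 1) * ('C(2 * p, p))%:R :> rat.
Proof.
have -> : 2 * p%:R + 1 = (2 * p).+1%:R :> rat by rewrite -[RHS]natr1 natrM.
rewrite natr1 -!natrM; congr _%:R; apply/eqP.
have e1 := mul_bin_diag (2 * p.+1) p.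
have e2 := mul_bin_diag (2 * p).+1 p.
have e3 : 'C((2 * p).+1, p) = 'C((2 * p).+1, p.+1).
  by rewrite -bin_sub; [congr 'C(_, _)|]; lia.
have e4 : (2 * p.+1).-1 = (2 * p).+1 by lia.
rewrite e4 /= in e1 e2; rewrite e3 in e1.
rewrite -(eqn_pmul2l (ltn0Sn p)); apply/eqP.
rewrite -e1; nia.
Qed.

Lemma bm_weight_succ_index (m k : nat) : (k < m)%N ->
  (2 * m%:R - 2 * k%:R - 1) * (k%:R + 1) * bm_weight m k.+1 =
  (m%:R - k%:R) * (m%:R + k%:R + 1) * bm_weight m k.
Proof.
move=> lt_km; have [p ->] : exists p, m = (k + p.+1)%N.
  by exists (m - k).-1; lia.
rewrite /bm_weight.
have -> : (2 * (k + p.+1) - 2 * k.+1 = 2 * p)%N by lia.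
have -> : (k + p.+1 - k.+1 = p)%N by lia.
have -> : (2 * (k + p.+1) - 2 * k = 2 * p.+1)%N by lia.
have -> : (k + p.+1 - k = p.+1)%N by lia.
have e1 := central_binS p.
have e2 : (k%:R + 1) * ('C(k + p.+1 + k.+1, k.+1))%:R =
   (2 * k%:R + p%:R + 2) * ('C(k + p.+1 + k, k))%:R :> rat.
  have -> : 2 * k%:R + p%:R + 2 = (k + p.+1 + k.+1)%:R :> rat.
    by rewrite !natrD -(natr1 p) -(natr1 k); ring.
  by rewrite natr1 -!natrM -mul_bin_diag addnS.
move: e1 e2; rewrite !natrM expnS natrM.
set B := ('C(_, p.+1))%:R; set B' := ('C(2 * p, p))%:R.
set C := ('C(_, k.+1))%:R; set C' := ('C(_, k))%:R.
set t := (2 ^ k)%:R; set u := _ ^- _.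
rewrite natrD -(natr1 p) => e1 e2.
transitivity (u * t * (2 * (2 * p%:R + 1) * B') * ((k%:R + 1) * C)).
  by ring.
by rewrite e2 -e1; ring.
Qed.

Lemma bm_weight_succ_order (m k : nat) : (k <= m)%N ->
  2 * (m%:R + 1) * (m%:R - k%:R + 1) * bm_weight m.+1 k =
  (2 * m%:R - 2 * k%:R + 1) * (m%:R + k%:R + 1) * bm_weight m k.
Proof.
move=> le_km; have [p ->] : exists p, m = (k + p)%N by exists (m - k)%N; lia.
rewrite /bm_weight.
have -> : (2 * (k + p).+1 - 2 * k = 2 * p.+1)%N by lia.
have -> : ((k + p).+1 - k = p.+1)%N by lia.
have -> : (2 * (k + p) - 2 * k = 2 * p)%N by lia.
have -> : (k + p - k = p)%N by lia.
have -> : 2%:R ^- (2 * (k + p).+1) = 4^-1 * 2%:R ^- (2 * (k + p)) :> rat.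
  have -> : (2 * (k + p).+1 = 2 + 2 * (k + p))%N by lia.
  by rewrite exprD invfM.
have e1 := central_binS p.
have e2 : (k%:R + p%:R + 1) * ('C((k + p).+1 + k, k))%:R =
   (2 * k%:R + p%:R + 1) * ('C(k + p + k, k))%:R :> rat.
  have -> : 2 * k%:R + p%:R + 1 = ((k + p).+1 + k)%:R :> rat.
    by rewrite natrD -[(k + p).+1%:R]natr1 natrD; ring.
  rewrite -natrD natr1 -!natrM; congr _%:R.
  have := mul_bin_down ((k + p).+1 + k) k.
  by rewrite addnK addSn /= => ->.
move: e1 e2; rewrite !natrM.
set B := ('C(_, p.+1))%:R; set B' := ('C(2 * p, p))%:R.
set C := ('C(_.+1 + k, k))%:R; set C' := ('C(_, k))%:R.
set t := (2 ^ k)%:R; set u := _ ^- _.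
rewrite natrD => e1 e2.
transitivity (2^-1 * u * t * ((p%:R + 1) * B) * ((k%:R + p%:R + 1) * C)).
  by field.
by rewrite e1 e2; field.
Qed.

(** Multiply by [m - k], pass from row [m + 1] to row [m], and split [m + k + 2] as
    [2 (k + 1) + (m - k)]; the index ratio turns the first part into [bm_weight m k]. *)
Lemma bm_weight_pascal (m k : nat) : (k < m)%N ->
  2 * (m%:R + 1) * bm_weight m.+1 k.+1 =
  2 * (m%:R + k%:R + 1) * bm_weight m k +
  (2 * m%:R - 2 * k%:R - 1) * bm_weight m k.+1.
Proof.
move=> lt_km.
have e1 := bm_weight_succ_index m k lt_km.
have e2 := bm_weight_succ_order m k.+1 lt_km.
have nz : m%:R - k%:R != 0 :> rat by rewrite -natrB ?pnatr_eq0; lia.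
apply: (mulfI nz); rewrite -(natr1 k) in e2.
transitivity (2 * (m%:R + 1) * (m%:R - (k%:R + 1) + 1) * bm_weight m.+1 k.+1).
  by ring.
rewrite e2 mulrDr.
transitivity (2 * ((m%:R - k%:R) * (m%:R + k%:R + 1) * bm_weight m k) +
  (m%:R - k%:R) * (2 * m%:R - 2 * k%:R - 1) * bm_weight m k.+1); last by ring.
by rewrite -e1; ring.
Qed.

Lemma bm_weight0_succ (m : nat) :
  2 * (m%:R + 1) * bm_weight m.+1 0 = (2 * m%:R + 1) * bm_weight m 0.
Proof.
have e := bm_weight_succ_order m 0 (leq0n _).
have nz : m%:R + 1 != 0 :> rat by rewrite natr1 pnatr_eq0.
by apply: (mulfI nz); lra.
Qed.

(** The upper end [k = m] of the Pascal rule, treated apart because [bm_weight m m.+1] is not 0. *)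
Lemma bm_weight_diag (m : nat) :
  2 * (m%:R + 1) * bm_weight m.+1 m.+1 = 2 * (2 * m%:R + 1) * bm_weight m m.
Proof.
rewrite /bm_weight !subnn !bin0 !muln1 !addnn -!mul2n.
have -> : 2%:R ^- (2 * m.+1) = 4^-1 * 2%:R ^- (2 * m) :> rat.
  have -> : (2 * m.+1 = 2 + 2 * m)%N by lia.
  by rewrite exprD invfM.
have e := central_binS m; move: e; rewrite !natrM expnS natrM.
set B := ('C(_, m.+1))%:R; set B' := ('C(_, m))%:R.
set t := (2 ^ m)%:R; set u := _ ^- _.
move=> e.
transitivity (u * t * ((m%:R + 1) * B)); first by field.
by rewrite e; ring.
Qed.

(** * Recurrences for the coefficients *)

Lemma mulr_bin_succ (k j : nat) :
  (j%:R + 1) * ('C(k, j.+1))%:R = (k%:R - j%:R) * ('C(k, j))%:R :> rat.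
Proof.
case: (leqP j k) => [le_jk|lt_kj]; last by rewrite !bin_small ?mulr0 //; lia.
by rewrite natr1 -natrB // -!natrM mul_bin_left.
Qed.

(** The Pascal rule transposed onto a test function; taking a binomial for [f] gives the recurrences
    in [m]. *)
Lemma sum_bm_weight_succ (m : nat) (f : nat -> rat) :
  2 * (m%:R + 1) * (\sum_(k < m.+2) bm_weight m.+1 k * f k) =
  \sum_(k < m.+1) bm_weight m k *
     (2 * (m%:R + k%:R + 1) * f k.+1 + (2 * m%:R + 1 - 2 * k%:R) * f k).
Proof.
under [RHS]eq_bigr => k _ do rewrite mulrDr.
rewrite big_split /= [X in _ = X + _]big_ord_recr [X in _ = _ + X]big_ord_recl /=.
rewrite big_ord_recl big_ord_recr /= /bump /=.
have e0 := bm_weight0_succ m; have em := bm_weight_diag m.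
have -> : 2 * (m%:R + 1) * (bm_weight m.+1 0 * f 0%N +
    (\sum_(k < m) bm_weight m.+1 k.+1 * f k.+1 +
     bm_weight m.+1 m.+1 * f m.+1)) =
  (2 * m%:R + 1) * bm_weight m 0 * f 0%N +
  \sum_(k < m) 2 * (m%:R + 1) * bm_weight m.+1 k.+1 * f k.+1 +
  2 * (2 * m%:R + 1) * bm_weight m m * f m.+1.
  under [in RHS]eq_bigr => k _ do rewrite -(mulrA (2 * (m%:R + 1))).
  by rewrite -e0 -em -mulr_sumr; ring.
rewrite (eq_bigr (fun k : 'I_m =>
    bm_weight m k * (2 * (m%:R + k%:R + 1) * f k.+1) +
    bm_weight m k.+1 * ((2 * m%:R + 1 - 2 * k.+1%:R) * f k.+1))); last first.
  move=> k _; rewrite (bm_weight_pascal m k (ltn_ord k)) -(natr1 k).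
  by ring.
by rewrite big_split /=; ring.
Qed.

Lemma bm_nat_succ0 (m : nat) :
  2 * (m%:R + 1) * bm_nat m.+1 0 = (4 * m%:R + 3) * bm_nat m 0.
Proof.
rewrite /bm_nat (sum_bm_weight_succ m (fun k => ('C(k, 0))%:R)) mulr_sumr.
by apply: eq_bigr => k _; rewrite !bin0; ring.
Qed.

Lemma bm_nat_succ (m j : nat) :
  2 * (m%:R + 1) * bm_nat m.+1 j.+1 =
  2 * (m%:R + j%:R + 1) * bm_nat m j +
  (4 * m%:R + 2 * j%:R + 5) * bm_nat m j.+1.
Proof.
rewrite /bm_nat (sum_bm_weight_succ m (fun k => ('C(k, j.+1))%:R)) !mulr_sumr.
rewrite -big_split; apply: eq_bigr => k _ /=; rewrite binS natrD.
have e := mulr_bin_succ k j.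
transitivity (bm_weight m k * ((4 * m%:R + 3) * ('C(k, j.+1))%:R +
   2 * (m%:R + j%:R + 1) * ('C(k, j))%:R + 2 * ((k%:R - j%:R) * ('C(k, j))%:R))).
  by ring.
by rewrite -e; ring.
Qed.

Lemma bm_nat_three_term (m j : nat) :
  (m%:R - j%:R) * (m%:R + j%:R + 1) * bm_nat m j +
  (j%:R + 1) * (j%:R + 2) * bm_nat m j.+2 =
  (j%:R + 1) * (2 * m%:R + 1) * bm_nat m j.+1.
Proof.
apply/eqP; rewrite -subr_eq0; apply/eqP.
(* Creative telescoping: this certificate vanishes at both [k = 0] and [k = m + 1]. *)
pose G k : rat := (2 * m%:R - 2 * k%:R + 1) * (k%:R - j%:R) * ('C(k, j))%:R *
  (if (k <= m)%N then bm_weight m k else 0).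
have Gk (k : 'I_m.+1) : bm_weight m k *
   ((m%:R - j%:R) * (m%:R + j%:R + 1) * ('C(k, j))%:R
    + (j%:R + 1) * (j%:R + 2) * ('C(k, j.+2))%:R
    - (j%:R + 1) * (2 * m%:R + 1) * ('C(k, j.+1))%:R) = G k.+1 - G k.
  have le_km : (k <= m)%N by rewrite -ltnS.
  have e1 := mulr_bin_succ k j; have e2 := mulr_bin_succ k j.+1.
  have e3 : (k.+1%:R - j%:R) * ('C(k.+1, j))%:R
      = (k%:R + 1) * ('C(k, j))%:R :> rat.
    by rewrite -mulr_bin_succ !natr1 -!natrM mul_bin_diag.
  have GS : G k.+1 = (m%:R - k%:R) * (m%:R + k%:R + 1) * bm_weight m k
      * ('C(k, j))%:R.
    rewrite /G; case: ltnP => [lt_km|ge_km].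
      rewrite -(bm_weight_succ_index m k lt_km) -natr1 in e3 *.
      transitivity ((2 * m%:R - 2 * k%:R - 1) * bm_weight m k.+1 *
        ((k%:R + 1 - j%:R) * ('C(k.+1, j))%:R)); first by ring.
      by rewrite e3; ring.
    (* Here [k = m]: the guard in [G] gives 0, in agreement with the factor [m - k]. *)
    rewrite mulr0.
    have -> : (k : nat) = m by apply/eqP; rewrite eqn_leq le_km.
    by rewrite subrr !mul0r.
  rewrite GS /G le_km.
  rewrite -(natr1 j) in e2.
  have -> : (j%:R + 1) * (j%:R + 2) * ('C(k, j.+2))%:R =
      (k%:R - (j%:R + 1)) * ((k%:R - j%:R) * ('C(k, j))%:R) :> rat.
    by rewrite -e1 mulrCA -e2; ring.
  have -> : (j%:R + 1) * (2 * m%:R + 1) * ('C(k, j.+1))%:R =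
      (2 * m%:R + 1) * ((k%:R - j%:R) * ('C(k, j))%:R) :> rat.
    by rewrite -e1; ring.
  by ring.
rewrite /bm_nat !mulr_sumr -big_split -sumrB /=.
rewrite (eq_bigr (fun k : 'I_m.+1 => G k.+1 - G k)) => [|k _]; last first.
  by rewrite -Gk; ring.
rewrite -(big_mkord xpredT (fun k => G k.+1 - G k)) telescope_sumr //.
rewrite /G ltnn mulr0 leq0n.
(* [G 0] contains [(0 - j) C(0, j) = (j + 1) C(0, j + 1) = 0], for every [j]. *)
rewrite -[_ * (0%:R - j%:R) * _]mulrA -mulr_bin_succ bin_small //.
by rewrite !(mulr0, mul0r) subr0.
Qed.

(** * Positivity, ratio bounds and log-concavity *)

Lemma bm_weight_gt0 (m k : nat) : 0 < bm_weight m k.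
Proof.
rewrite /bm_weight mulr_gt0 ?invr_gt0 ?exprn_gt0 //.
by rewrite ltr0n !muln_gt0 expn_gt0 !bin_gt0 /=; lia.
Qed.

Lemma bm_nat_gt0 (m j : nat) : (j <= m)%N -> 0 < bm_nat m j.
Proof.
move=> le_jm; rewrite /bm_nat big_ord_recr /= ltr_wpDl //.
  by apply: sumr_ge0 => k _; rewrite mulr_ge0 ?ler0n // ltW ?bm_weight_gt0.
by rewrite mulr_gt0 ?bm_weight_gt0 // ltr0n bin_gt0.
Qed.

Lemma bm_nat_ge0 (m j : nat) : 0 <= bm_nat m j.
Proof.
by apply: sumr_ge0 => k _; rewrite mulr_ge0 ?ler0n // ltW ?bm_weight_gt0.
Qed.

Lemma bm_nat_small (m j : nat) : (m < j)%N -> bm_nat m j = 0.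
Proof.
move=> lt_mj; rewrite /bm_nat big1 // => k _.
by rewrite bin_small ?mulr0 //; exact: leq_trans (ltn_ord k) lt_mj.
Qed.

Lemma bm_nat_ratio_le (m j : nat) : (j <= m)%N ->
  (j%:R + 1) * bm_nat m j.+1 <= (m%:R - j%:R) * bm_nat m j.
Proof.
move=> le_jm; have [p def_m] : exists p, m = (j + p)%N.
  by exists (m - j)%N; lia.
elim: p j {le_jm} def_m => [|p IHp] j def_m.
  by rewrite (bm_nat_small m j.+1) ?def_m ?addn0 // subrr mulr0 mul0r.
have := IHp j.+1; rewrite addSnnS => /(_ def_m) {IHp}.
have := bm_nat_three_term m j; have := bm_nat_ge0 m j.+1.
rewrite def_m natrD -!natr1.
move: (bm_nat _ j) (bm_nat _ j.+1) (bm_nat _ j.+2) => a b c.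
have : 0 <= j%:R :> rat by []; have : 0 <= p%:R :> rat by [].
move: (j%:R : rat) (p%:R : rat) => x y {def_m} y0 x0 b0 e IH.
(* This is the factor [m + j + 1] of [a] in the three-term recurrence; bounding [c] there by [IH]
   proves the claim with [(j + 1) b] to spare. *)
have D0 : 0 < 2 * x + y + 2 by lra.
have x1 : 0 <= x + 1 by lra.
rewrite -(ler_pM2r D0).
by have := ler_wpM2l x1 IH; have := mulr_ge0 x1 b0; lra.
Qed.

(** Same elimination of the term at [j + 2] as in the induction above, now keeping the spare
    [(j + 1) b]. *)
Lemma bm_nat_ratio_ge (m j : nat) : (j < m)%N ->
  (j%:R + 1) * (m%:R + j%:R + 2) * bm_nat m j.+1 <=
  (m%:R - j%:R) * (m%:R + j%:R + 1) * bm_nat m j.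
Proof.
move=> lt_jm; have := bm_nat_ratio_le m j.+1 lt_jm.
have := bm_nat_three_term m j; rewrite -!natr1.
by have := ler0n rat j; nra.
Qed.

(** This is the second inequality of the theorem after expanding row [m + 1]; the mixed products
    [a_j a_{j+1}] cancel up to the coefficient 2. *)
Lemma bm_nat_quadratic_gt0 (m j : nat) : (j < m)%N ->
  2 * bm_nat m j * bm_nat m j.+1 +
  (4 * m%:R + 2 * j%:R + 7) * bm_nat m j * bm_nat m j.+2 <
  (4 * m%:R + 2 * j%:R + 5) * bm_nat m j.+1 ^+ 2.
Proof.
move=> lt_jm; have le := bm_nat_ratio_ge m j lt_jm.
have e := bm_nat_three_term m j; have b0 := bm_nat_gt0 m j.+1 lt_jm.
move: le e b0; have [p ->] : exists p, m = (j + p.+1)%N.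
  by exists (m - j).-1; lia.
rewrite natrD -natr1.
move: (bm_nat _ j) (bm_nat _ j.+1) (bm_nat _ j.+2) => a b c.
have : 0 <= j%:R :> rat by []; have : 0 <= p%:R :> rat by [].
move: (j%:R : rat) (p%:R : rat) => x y y0 x0 le e b0.
(* [x = j], [y + 1 = m - j], and [s] is the excess in the ratio bound. *)
pose s := (y + 1) * (2 * x + y + 2) * a - (x + 1) * (2 * x + y + 3) * b.
have s0 : 0 <= s by rewrite /s; lra.
have P0 : 0 < (y + 1) * (2 * x + y + 2) by rewrite mulr_gt0; lra.
have Q0 : 0 < (x + 1) * (x + 2) by rewrite mulr_gt0; lra.
have ea : (y + 1) * (2 * x + y + 2) * a = (x + 1) * (2 * x + y + 3) * b + s.
  by rewrite /s; ring.
(* The three-term recurrence with [a] replaced through [ea]. The opposite signs of [s] in [ea] and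
   [ec] make the [s * s] term of the form positive. *)
have ec : (x + 1) * (x + 2) * c = (x + 1) * y * b - s.
  by rewrite /s; lra.
rewrite -subr_gt0 -(pmulr_rgt0 _ P0) -(pmulr_rgt0 _ Q0).
(* [M] is [m] and [I] is [j + 1]; in these the coefficient of [b * b] is visibly positive. *)
set M := x + y + 1; set I := x + 1.
suff -> : (x + 1) * (x + 2) * ((y + 1) * (2 * x + y + 2) *
   ((4 * (x + (y + 1)) + 2 * x + 5) * b ^+ 2 -
    (2 * a * b + (4 * (x + (y + 1)) + 2 * x + 7) * a * c))) =
   I * ((4 * M + 3) * (M * M + M) + (I * I + I) * (2 * M + 2 * I + 1)) * (b * b)
   + I * ((6 * x + 4 * y + 11) * (2 * x + 3) - 2 * (x + 2)) * (b * s)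
   + (6 * x + 4 * y + 11) * (s * s).
  have M0 : 0 < M by rewrite /M; lra.
  have I0 : 0 < I by rewrite /I; lra.
  have MM0 := mulr_gt0 M0 M0; have II0 := mulr_gt0 I0 I0.
  have c1 : 0 < (4 * M + 3) * (M * M + M) by rewrite mulr_gt0; lra.
  have c2 : 0 < (I * I + I) * (2 * M + 2 * I + 1) by rewrite mulr_gt0; lra.
  have xx0 := mulr_ge0 x0 x0; have xy0 := mulr_ge0 x0 y0.
  have c3 : 0 <= (6 * x + 4 * y + 11) * (2 * x + 3) - 2 * (x + 2) by lra.
  have c4 : 0 <= 6 * x + 4 * y + 11 by lra.
  rewrite -addrA ltr_wpDr //; last by rewrite !mulr_gt0 // addr_gt0.
  by rewrite addr_ge0 // !mulr_ge0 // ltW.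
transitivity ((x + 1) * (x + 2) * ((y + 1) * (2 * x + y + 2)) *
    (4 * (x + (y + 1)) + 2 * x + 5) * b ^+ 2 -
   2 * ((x + 1) * (x + 2)) * b * ((y + 1) * (2 * x + y + 2) * a) -
   (4 * (x + (y + 1)) + 2 * x + 7) * ((y + 1) * (2 * x + y + 2) * a) *
   ((x + 1) * (x + 2) * c)); first by ring.
by rewrite ea ec /M /I; ring.
Qed.

(** Drop [2 a_j a_{j+1}] and [2 a_j a_{j+2}] from the quadratic inequality; the two remaining
    coefficients agree. *)
Lemma bm_nat_log_concave (m j : nat) : (j < m)%N ->
  bm_nat m j * bm_nat m j.+2 <= bm_nat m j.+1 ^+ 2.
Proof.
move=> lt_jm; have := bm_nat_quadratic_gt0 m j lt_jm.
have := mulr_ge0 (bm_nat_ge0 m j) (bm_nat_ge0 m j.+1).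
have := mulr_ge0 (bm_nat_ge0 m j) (bm_nat_ge0 m j.+2).
have D0 : 0 < 4 * m%:R + 2 * j%:R + 5 :> rat.
  by have := ler0n rat m; have := ler0n rat j; lra.
by move=> ? ? ?; rewrite -(ler_pM2l D0); lra.
Qed.

(** * The two interlacing inequalities *)

Lemma bm_nat_interlace_lower (m j : nat) : (j <= m)%N ->
  bm_nat m j.+1 * bm_nat m.+1 j < bm_nat m j * bm_nat m.+1 j.+1.
Proof.
move=> le_jm; have D0 : 0 < 2 * (m%:R + 1) :> rat by rewrite natr1 mulr_gt0.
rewrite -(ltr_pM2l D0) mulrCA [ltRHS]mulrCA bm_nat_succ.
case: j le_jm => [|j] lt_jm.
  rewrite bm_nat_succ0; have a0 := bm_nat_gt0 m 0 lt_jm.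
  have b0 := mulr_ge0 (ltW a0) (bm_nat_ge0 m 1).
  by have := mulr_gt0 (mulr_gt0 D0 a0) a0; lra.
(* With [a, b, c] the coefficients at [j], [j.+1], [j.+2], the difference of the sides is [2 (m + j
   + 2) b^2 - 2 (m + j + 1) a c + 2 b c], at least [2 b^2] by log-concavity. *)
rewrite bm_nat_succ -!natr1.
have := bm_nat_log_concave m j lt_jm; have b0 := bm_nat_gt0 m j.+1 lt_jm.
have := mulr_ge0 (ltW b0) (bm_nat_ge0 m j.+2); have := mulr_gt0 b0 b0.
have E0 : 0 <= m%:R + j%:R + 1 :> rat by rewrite !addr_ge0.
by move=> ? ? /(ler_wpM2l E0) ?; lra.
Qed.

Lemma bm_nat_interlace_upper (m j : nat) : (j < m)%N ->
  bm_nat m j * bm_nat m.+1 j.+2 < bm_nat m j.+1 * bm_nat m.+1 j.+1.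
Proof.
move=> lt_jm; have D0 : 0 < 2 * (m%:R + 1) :> rat by rewrite natr1 mulr_gt0.
rewrite -(ltr_pM2l D0) mulrCA [ltRHS]mulrCA !bm_nat_succ -natr1.
by have := bm_nat_quadratic_gt0 m j lt_jm; lra.
Qed.

Theorem theorem1 (m : nat) (i : int) :
  (2 <= m)%N -> 0 <= i <= m%:Z ->
  boros_moll_coef m i * boros_moll_coef m.+1 (i + 1) >
    boros_moll_coef m (i + 1) * boros_moll_coef m.+1 i
  /\
  boros_moll_coef m i * boros_moll_coef m.+1 i >
    boros_moll_coef m (i - 1) * boros_moll_coef m.+1 (i + 1).
Proof.
move=> _ /andP[]; case: i => [j|//] _; rewrite lez_nat => le_jm.
have -> : j%:Z + 1 = j.+1%:Z by rewrite -addn1 PoszD.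
rewrite !boros_moll_coef_nat; split; first exact: bm_nat_interlace_lower.
case: j le_jm => [|j] lt_jm.
  (* At [i = 0] the coefficient of index [-1] is 0 by convention. *)
  rewrite [X in X * _ < _](_ : _ = 0) // mul0r.
  by rewrite mulr_gt0 ?bm_nat_gt0.
have -> : j.+1%:Z - 1 = j%:Z by rewrite -addn1 PoszD addrK.
by rewrite boros_moll_coef_nat; exact: bm_nat_interlace_upper.
Qed.
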